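(* Let $\mathcal{A}=\mathcal{A}_0\oplus\mathcal{A}_1$ be a superspace endowed with two even bilinear operations $[\cdot,\cdot]$ and $\circ$, and an even linear selfmap $\alpha$. Let $$\mathcal{L}(\mathcal{A})=\mathcal{A}_0\otimes\mathbb{C}[t,t^{-1}]\ \oplus\ \mathcal{A}_1\otimes t^{\frac12}\mathbb{C}[t,t^{-1}]$$ with the bilinear operation $[-,-]$ determined, for homogeneous $u,v\in\mathcal{A}$ and $m,n\in\mathbb{Z}$, by $$[u\otimes t^{m+\frac{|u|}{2}},v\otimes t^{n+\frac{|v|}{2}}]=[u,v]\otimes t^{m+n+\frac{|u|+|v|}{2}}+\Big(m+\frac{|u|}{2}\Big)u\circ v\otimes t^{m+n+\frac{|u|+|v|}{2}-1}-(-1)^{|u||v|}\Big(n+\frac{|v|}{2}\Big)v\circ u\otimes t^{m+n+\frac{|u|+|v|}{2}-1},$$ and let $\varphi:\mathcal{L}(\mathcal{A})\to\mathcal{L}(\mathcal{A})$ be the even linear map with $\varphi(u\otimes t^{m+\frac{|u|}{2}})=\alpha(u)\otimes t^{m+\frac{|u|}{2}}$ for homogeneous $u\in\mathcal{A}$, $m\in\mathbb{Z}$. Then $(\mathcal{L}(\mathcal{A}),[-,-],\varphi)$ is a Hom-Lie superalgebra if and only if $(\mathcal{A},[\cdot,\cdot],\circ,\alpha)$ is a super Hom-Gel'fand-Dorfman bialgebra.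
   Context: All linear spaces and tensor products are over $\mathbb{C}$. A superspace is a $\mathbb{Z}_2$-graded linear space $\mathcal{A}=\mathcal{A}_0\oplus\mathcal{A}_1$; $|x|\in\{0,1\}$ is the parity of a homogeneous element $x$. Formulas containing $|x|$ are stated for homogeneous elements and extended by linearity. In exponents and coefficients such as $\frac{|u|}{2}$ the parity $|u|$ is read as the integer $0$ or $1$. The superspace $\mathcal{L}(\mathcal{A})$ has even part $\mathcal{A}_0\otimes\mathbb{C}[t,t^{-1}]$ and odd part $\mathcal{A}_1\otimes t^{1/2}\mathbb{C}[t,t^{-1}]$. Hom-Lie superalgebra $(\mathcal{A},[\cdot,\cdot],\alpha)$: a superspace with an even bilinear map $[\cdot,\cdot]:\mathcal{A}\times\mathcal{A}\to\mathcal{A}$ and an even linear map $\alpha:\mathcal{A}\to\mathcal{A}$ such that for all homogeneous $x,y,z$: $[x,y]=-(-1)^{|x||y|}[y,x]$ and $(-1)^{|x||z|}[[x,y],\alpha(z)]+(-1)^{|x||y|}[[y,z],\alpha(x)]+(-1)^{|y||z|}[[z,x],\alpha(y)]=0$. Hom-Novikov superalgebra $(\mathcal{A},\circ,\alpha)$: a superspace with an even bilinear operation $\circ$ and an even linear map $\alpha$ such that for all homogeneous $x,y,z$: $(x\circ y)\circ\alpha(z)-\alpha(x)\circ(y\circ z)=(-1)^{|x||y|}\big((y\circ x)\circ\alpha(z)-\alpha(y)\circ(x\circ z)\big)$ and $(x\circ y)\circ\alpha(z)=(-1)^{|y||z|}(x\circ z)\circ\alpha(y)$. Super Hom-Gel'fand-Dorfman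 bialgebra $(\mathcal{A},[\cdot,\cdot],\circ,\alpha)$: a superspace with an even linear map $\alpha$ and two operations such that $(\mathcal{A},[\cdot,\cdot],\alpha)$ is a Hom-Lie superalgebra, $(\mathcal{A},\circ,\alpha)$ is a Hom-Novikov superalgebra, and for all homogeneous $x,y,z$: $[x\circ y,\alpha(z)]-(-1)^{|y||z|}[x\circ z,\alpha(y)]+[x,y]\circ\alpha(z)-(-1)^{|y||z|}[x,z]\circ\alpha(y)-\alpha(x)\circ[y,z]=0$. *)

(* Defs.v *)
From HB Require Import structures.
From mathcomp Require Import all_boot all_order all_algebra.
From mathcomp Require Import finmap.
From mathcomp Require Import boolp classical_sets functions cardinality fsbigop.
From mathcomp Require Import reals.
From mathcomp Require Import complex.

Set Implicit Arguments.
Unset Strict Implicit.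
Unset Printing Implicit Defensive.

Import Order.TTheory GRing.Theory Num.Theory.
Local Open Scope classical_set_scope.
Local Open Scope ring_scope.

(* The grading group Z/2 is bool: false is the even parity, true the odd one. *)
HB.mixin Record Lmodule_isSuperspace (K : numFieldType) A
    of GRing.Lmodule K A := {
  homog : bool -> {pred A};
  homog_submod_closed : forall a, submod_closed (homog a);
  homog_decomp : forall x : A,
    exists x0 x1, [/\ x0 \in homog false, x1 \in homog true & x = x0 + x1];
  homog_cap : forall x : A, x \in homog false -> x \in homog true -> x = 0
}.

#[short(type="superspaceType")]
HB.structure Definition Superspace (K : numFieldType) :=
  { A of GRing.Lmodule K A & Lmodule_isSuperspace K A }.

Section HomSuperalgebras.
Variables (K : numFieldType) (A : superspaceType K).
Implicit Types (br circ : A -> A -> A) (alpha : A -> A) (a b c : bool).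

Definition even_linear alpha : Prop :=
  linear alpha /\ forall a x, x \in homog a -> alpha x \in homog a.

Definition even_bilinear br : Prop :=
  bilinear_for *:%R *:%R br /\
  forall a b x y, x \in homog a -> y \in homog b -> br x y \in homog (a (+) b).

(* The sign (-1)^{|x||y|} for x of parity a and y of parity b. *)
Definition ksign a b : K := (-1) ^+ (a * b)%N.

Definition hom_lie_superalgebra br alpha : Prop :=
  [/\ even_bilinear br, even_linear alpha,
    forall a b x y, x \in homog a -> y \in homog b ->
      br x y = - (ksign a b *: br y x)
  & forall a b c x y z, x \in homog a -> y \in homog b -> z \in homog c ->
      ksign a c *: br (br x y) (alpha z)
      + ksign a b *: br (br y z) (alpha x)
      + ksign b c *: br (br z x) (alpha y) = 0].

Definition hom_novikov_superalgebra circ alpha : Prop :=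
  [/\ even_bilinear circ, even_linear alpha,
    forall a b c x y z, x \in homog a -> y \in homog b -> z \in homog c ->
      circ (circ x y) (alpha z) - circ (alpha x) (circ y z)
      = ksign a b *: (circ (circ y x) (alpha z) - circ (alpha y) (circ x z))
  & forall a b c x y z, x \in homog a -> y \in homog b -> z \in homog c ->
      circ (circ x y) (alpha z) = ksign b c *: circ (circ x z) (alpha y)].

Definition super_hom_gelfand_dorfman br circ alpha : Prop :=
  [/\ hom_lie_superalgebra br alpha, hom_novikov_superalgebra circ alpha
  & forall a b c x y z, x \in homog a -> y \in homog b -> z \in homog c ->
      br (circ x y) (alpha z) - ksign b c *: br (circ x z) (alpha y)
      + circ (br x y) (alpha z) - ksign b c *: circ (br x z) (alpha y)
      - circ (alpha x) (br y z) = 0].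

End HomSuperalgebras.

Definition parz (k : int) : bool := odd `|k|%N.

Lemma parz_half (m : int) (a : bool) : parz (m * 2 + (a : nat)%:Z) = a.
Proof.
have -> : parz (m * 2 + (a : nat)%:Z) = ~~ (2 %| m * 2 + (a : nat)%:Z)%Z.
  by rewrite dvdzE dvdn2 negbK.
by rewrite rpredDl ?dvdz_mull // dvdzE dvdn2 negbK; case: a.
Qed.

(* L(A) is the direct sum over the k in int of the A_{k mod 2} (x) t^{k/2}: an  *)
(* element is a finitely supported f : int -> A, standing for                 *)
(* \sum_k f k (x) t^{k/2}, with f k of parity k mod 2. Thus the exponent      *)
(* m + |u|/2 is encoded by the integer 2m + |u|.                              *)
Section Loop.
Variables (K : numFieldType) (A : superspaceType K).

Definition loop_pred : {pred int -> A} := fun f =>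
  `[< finite_set [set k | f k != 0] /\ forall k, f k \in homog (parz k) >].

Fact loop_submod_closed : submod_closed loop_pred.
Proof.
split=> [|c f g /asboolP[ff hf] /asboolP[fg hg]]; apply/asboolP; split.
- by rewrite (_ : mkset _ = set0) // -subset0 => k /=; rewrite eqxx.
- by move=> k; have [] := homog_submod_closed (s := A) (parz k).
- apply: (@sub_finite_set _ _ ([set k | f k != 0] `|` [set k | g k != 0])).
    move=> k /= h; have [f0|] := eqVneq (f k) 0; last by left.
    right; apply: contra h => /eqP g0.
    by rewrite /GRing.add /= /GRing.scale /= f0 g0 scaler0 addr0.
  by rewrite finite_setU.
- move=> k; have [_] := homog_submod_closed (s := A) (parz k).
  by apply; [exact: hf | exact: hg].
Qed.

HB.instance Definition _ :=
  GRing.isSubmodClosed.Build K (int -> A) loop_pred loop_submod_closed.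

Record loop := Loop { loop_coef :> int -> A; loopP : loop_coef \in loop_pred }.
HB.instance Definition _ := [isSub for loop_coef].
HB.instance Definition _ := [Choice of loop by <:].
HB.instance Definition _ := [SubChoice_isSubLmodule of loop by <:].

Definition loop_homog (b : bool) : {pred loop} := fun f =>
  `[< forall k, parz k != b -> f k = 0 >].

Lemma loop_coefP (f : loop) :
  finite_set [set k | f k != 0] /\ forall k, f k \in homog (parz k).
Proof. exact/asboolP/(loopP f). Qed.

Lemma loopD (f g : loop) k : (f + g) k = f k + g k. Proof. by []. Qed.
Lemma loopZ (c : K) (f : loop) k : (c *: f) k = c *: f k. Proof. by []. Qed.
Lemma loop_ext (f g : loop) : (forall k, f k = g k) -> f = g.
Proof. by move=> h; apply/val_inj/funext. Qed.

Fact loop_homog_submod b : submod_closed (loop_homog b).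
Proof.
split=> [|c f g /asboolP hf /asboolP hg]; apply/asboolP => k kb //.
by rewrite loopD loopZ hf // hg // scaler0 addr0.
Qed.

Fact loop_part_subproof (f : loop) b :
  (fun k => if parz k == b then f k else 0) \in loop_pred.
Proof.
have [ff hf] := loop_coefP f; apply/asboolP; split.
  by apply: sub_finite_set ff => k /=; case: ifP; rewrite ?eqxx.
move=> k; case: ifP => _; first exact: hf.
by have [] := homog_submod_closed (s := A) (parz k).
Qed.

Fact loop_homog_decomp (f : loop) : exists f0 f1,
  [/\ f0 \in loop_homog false, f1 \in loop_homog true & f = f0 + f1].
Proof.
exists (Loop (loop_part_subproof f false)), (Loop (loop_part_subproof f true)).
split; [apply/asboolP | apply/asboolP | apply: loop_ext] => k.
- by move=> /= /negPf ->.
- by move=> /= /negPf ->.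
by rewrite loopD /=; case: (parz k); rewrite /= ?add0r ?addr0.
Qed.

Fact loop_homog_cap (f : loop) :
  f \in loop_homog false -> f \in loop_homog true -> f = 0.
Proof.
move=> /asboolP h0 /asboolP h1; apply: loop_ext => k.
by case e: (parz k); [rewrite h0 | rewrite h1] => //; rewrite e.
Qed.

HB.instance Definition _ := Lmodule_isSuperspace.Build K loop
  loop_homog_submod loop_homog_decomp loop_homog_cap.

(* u (x) t^{k/2}; this is 0 by convention when u is not of parity k mod 2. *)
Definition tmon (u : A) (k : int) : loop :=
  insubd 0 (fun j : int => if j == k then u else 0).

Lemma tmonE u k j : u \in homog (parz k) ->
  tmon u k j = if j == k then u else 0.
Proof.
move=> uk; rewrite /tmon insubdK //; apply/asboolP; split.
  apply: (@sub_finite_set _ _ [set k]); last exact: finite_set1.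
  by move=> i /=; have [//|_] := eqVneq i k; rewrite eqxx.
move=> i; case: eqP => [->|_] //.
by have [] := homog_submod_closed (s := A) (parz i).
Qed.

Lemma tmon_bad u k : u \notin homog (parz k) -> tmon u k = 0.
Proof.
move=> uk; rewrite /tmon /insubd insubF //; apply: contraNF uk.
by move=> /asboolP[_ /(_ k)]; rewrite eqxx.
Qed.

Lemma tmon_linear k u v (c : K) : u \in homog (parz k) ->
  v \in homog (parz k) -> tmon (c *: u + v) k = c *: tmon u k + tmon v k.
Proof.
move=> uk vk; apply: loop_ext => j; rewrite loopD loopZ !tmonE //.
  by case: eqP => //; rewrite scaler0 addr0.
by have [_] := homog_submod_closed (s := A) (parz k); apply.
Qed.

Lemma tmon0 k : tmon 0 k = 0.
Proof.
apply: loop_ext => j; rewrite tmonE ?if_same //.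
by have [] := homog_submod_closed (s := A) (parz k).
Qed.

(* The bracket of u (x) t^{i/2} and v (x) t^{j/2}, with i/2 = m + |u|/2 and    *)
(* j/2 = n + |v|/2; loop_bracket_tmon restates it in terms of m and n.        *)
Definition bracket_term (br circ : A -> A -> A) (i j : int) (u v : A) : loop :=
  tmon (br u v) (i + j)
  + (i%:~R / 2) *: tmon (circ u v) (i + j - 2)
  - ksign K (parz i) (parz j) *:
      ((j%:~R / 2) *: tmon (circ v u) (i + j - 2)).

Definition loop_bracket (br circ : A -> A -> A) (f g : loop) : loop :=
  \sum_(i \in [set: int]) \sum_(j \in [set: int])
    bracket_term br circ i j (f i) (g j).

Definition loop_map (alpha : A -> A) (f : loop) : loop :=
  \sum_(i \in [set: int]) tmon (alpha (f i)) i.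

Lemma fsum_pt (V : zmodType) (F : int -> V) k :
  (forall i, i != k -> F i = 0) -> \sum_(i \in [set: int]) F i = F k.
Proof.
move=> Fk; rewrite -(fsbig_widen [set k]) ?fsbig_set1 // => i /= [_ /eqP].
exact: Fk.
Qed.

Lemma homog0 a : (0 : A) \in homog a.
Proof. by have [] := homog_submod_closed (s := A) a. Qed.

Lemma fsum_wid (V : zmodType) (S : set int) (H : int -> V) :
  finite_set S -> (forall i, ~ S i -> H i = 0) ->
  \sum_(i \in [set: int]) H i = \sum_(i <- fset_set S) H i.
Proof.
move=> fS HS; rewrite -fsbig_finite //; apply/esym/fsbig_widen => // i [_].
exact: HS.
Qed.

Lemma fsum_lin (V : lmodType K) (F G : int -> V) c :
  finite_set [set i | F i != 0] -> finite_set [set i | G i != 0] ->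
  \sum_(i \in [set: int]) (c *: F i + G i) =
  c *: (\sum_(i \in [set: int]) F i) + \sum_(i \in [set: int]) G i.
Proof.
move=> fF fG; set S := [set i | F i != 0] `|` [set i | G i != 0].
have fS : finite_set S by rewrite finite_setU.
have ST i : ~ S i -> F i = 0 /\ G i = 0.
  by move=> iS; split; apply: contrapT => /eqP h; apply: iS; [left | right].
rewrite !(fsum_wid fS); first by rewrite scaler_sumr big_split.
all: by move=> i /ST[F0 G0]; rewrite ?F0 ?G0 ?scaler0 ?addr0.
Qed.

Lemma sub_supp (V : zmodType) (f : loop) (F : int -> V) :
  (forall i, f i = 0 -> F i = 0) -> finite_set [set i | F i != 0].
Proof.
move=> h; have [ff _] := loop_coefP f; apply: sub_finite_set ff => i /=.
by apply: contra => /eqP/h ->.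
Qed.

Lemma fsum_coef (f : loop) (F : int -> loop) k :
  (forall i, f i = 0 -> F i = 0) ->
  (\sum_(i \in [set: int]) F i) k = \sum_(i \in [set: int]) F i k.
Proof.
move=> h; have fF := sub_supp h; set S := [set i | F i != 0] in fF.
have FS i : ~ S i -> F i = 0 by move=> iS; apply: contrapT => /eqP.
rewrite !(fsum_wid fF) // => [|i /FS -> //].
by elim/big_rec2: _ => // i x y _ <-; rewrite loopD.
Qed.

Lemma loop_mapE alpha (f : loop) k : even_linear alpha ->
  loop_map alpha f k = alpha (f k).
Proof.
move=> [alin aev]; pose al := GRing.isLinear.Build K A A *:%R alpha alin.
pose aL : {linear A -> A} := HB.pack alpha al.
have a0 : alpha 0 = 0 := linear0 aL.
have [_ hf] := loop_coefP f.
have aE i : tmon (alpha (f i)) i k = if k == i then alpha (f i) else 0.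
  by rewrite tmonE //; exact: aev.
rewrite /loop_map (@fsum_coef f) => [|i ->]; last by rewrite a0 tmon0.
rewrite (@fsum_pt _ _ k) ?aE ?eqxx // => i ik.
by rewrite aE eq_sym (negPf ik).
Qed.

Lemma loop_map_tmon alpha u k : even_linear alpha -> u \in homog (parz k) ->
  loop_map alpha (tmon u k) = tmon (alpha u) k.
Proof.
move=> ha uk; have [alin aev] := ha.
pose aL : {linear A -> A} :=
  HB.pack alpha (GRing.isLinear.Build K A A *:%R alpha alin).
apply: loop_ext => j; rewrite loop_mapE // !tmonE ?aev //.
by case: eqP => // _; exact: (linear0 aL).
Qed.

Lemma loop_map_even alpha : even_linear alpha -> even_linear (loop_map alpha).
Proof.
move=> ha; have [alin aev] := ha; split=> [c f g|a f /asboolP fa].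
  by apply: loop_ext => k; rewrite loopD loopZ !loop_mapE // alin.
apply/asboolP => k ka; rewrite loop_mapE // fa //.
pose aL : {linear A -> A} :=
  HB.pack alpha (GRing.isLinear.Build K A A *:%R alpha alin).
exact: (linear0 aL).
Qed.

Lemma loop_tmon_sum (f : loop) : f = \sum_(k \in [set: int]) tmon (f k) k.
Proof.
have h : even_linear (@id A) by split.
by apply: loop_ext => k; rewrite -[in LHS](loop_mapE f k h).
Qed.

Lemma parzD i j : parz (i + j) = parz i (+) parz j.
Proof.
rewrite (divz_eq i 2) (divz_eq j 2).
have hm k : exists a : bool, (k %% 2)%Z = (a : nat)%:Z.
  have := ltz_pmod k (isT : 0 < 2 :> int); have := modz_ge0 k (isT : 2 != 0 :> int).
  by case: (k %% 2)%Z => [[|[|?]]|?] // _ _; [exists false | exists true].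
have [[a ->] [b ->]] := (hm i, hm j); rewrite !parz_half addrACA -mulrDl.
case: a; case: b; rewrite ?addr0 ?add0r ?parz_half //.
- by have := parz_half ((i %/ 2)%Z + (j %/ 2)%Z + 1) false; rewrite addr0 !mulrDl mul1r.
by have := parz_half ((i %/ 2)%Z + (j %/ 2)%Z) false; rewrite addr0.
Qed.

Section Bracket.
Variables (br circ : A -> A -> A).
Hypotheses (hbr : even_bilinear br) (hcirc : even_bilinear circ).

Let bil0 (op : A -> A -> A) : even_bilinear op -> (forall v, op 0 v = 0) * (forall u, op u 0 = 0).
Proof.
move=> [[l r] _]; split=> x.
  have := l x 1 0 0; rewrite /= scaler0 scale1r add0r => h.
  by apply: (addrI (op 0 x)); rewrite addr0 -h.
have := r x 1 0 0; rewrite /= scaler0 scale1r add0r => h.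
by apply: (addrI (op x 0)); rewrite addr0 -h.
Qed.

Let par2 k : parz (k - 2) = parz k.
Proof. by rewrite parzD /= addbF. Qed.

Let term0l i j v : bracket_term br circ i j 0 v = 0.
Proof.
by rewrite /bracket_term !(bil0 hbr) !(bil0 hcirc) !tmon0 !scaler0 addr0 subr0.
Qed.

Let term0r i j u : bracket_term br circ i j u 0 = 0.
Proof.
by rewrite /bracket_term !(bil0 hbr) !(bil0 hcirc) !tmon0 !scaler0 addr0 subr0.
Qed.

Let sum6 (p q r s t w : loop) :
  p + q + (r + s) + (t + w) = p + r + t + (q + s + w).
Proof. by rewrite (addrACA p) (addrACA (p + r)). Qed.

Let term_linl i j c u u' v : u \in homog (parz i) -> u' \in homog (parz i) ->
  v \in homog (parz j) ->
  bracket_term br circ i j (c *: u + u') v =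
  c *: bracket_term br circ i j u v + bracket_term br circ i j u' v.
Proof.
move=> hu hu' hv; have [[bl br_] be] := hbr; have [[cl cr] ce] := hcirc.
have e1 : parz (i + j) = parz i (+) parz j by rewrite parzD.
have e2 : parz (i + j - 2) = parz i (+) parz j by rewrite par2 parzD.
have cu w w' : w \in homog (parz i) -> w' \in homog (parz j) ->
  circ w w' \in homog (parz (i + j - 2)) by rewrite e2; apply: ce.
have cs w w' : w \in homog (parz j) -> w' \in homog (parz i) ->
  circ w w' \in homog (parz (i + j - 2)) by rewrite e2 addbC; apply: ce.
have bu w w' : w \in homog (parz i) -> w' \in homog (parz j) ->
  br w w' \in homog (parz (i + j)) by rewrite e1; apply: be.
rewrite /bracket_term bl cl cr /=.
rewrite !tmon_linear; try by [apply: cu | apply: cs | apply: bu].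
move: (i + j - 2) => k.
rewrite !scalerDr !scalerN !scalerA 2!(mulrC _ c) !mulrA opprD.
exact: sum6.
Qed.

Let term_linr i j c u v v' : u \in homog (parz i) -> v \in homog (parz j) ->
  v' \in homog (parz j) ->
  bracket_term br circ i j u (c *: v + v') =
  c *: bracket_term br circ i j u v + bracket_term br circ i j u v'.
Proof.
move=> hu hu' hv; have [[bl br_] be] := hbr; have [[cl cr] ce] := hcirc.
have e1 : parz (i + j) = parz i (+) parz j by rewrite parzD.
have e2 : parz (i + j - 2) = parz i (+) parz j by rewrite par2 parzD.
have cu w w' : w \in homog (parz i) -> w' \in homog (parz j) ->
  circ w w' \in homog (parz (i + j - 2)) by rewrite e2; apply: ce.
have cs w w' : w \in homog (parz j) -> w' \in homog (parz i) ->
  circ w w' \in homog (parz (i + j - 2)) by rewrite e2 addbC; apply: ce.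
have bu w w' : w \in homog (parz i) -> w' \in homog (parz j) ->
  br w w' \in homog (parz (i + j)) by rewrite e1; apply: be.
rewrite /bracket_term br_ cl cr /=.
rewrite !tmon_linear; try by [apply: cu | apply: cs | apply: bu].
move: (i + j - 2) => k.
rewrite !scalerDr !scalerN !scalerA 2!(mulrC _ c) !mulrA opprD.
exact: sum6.
Qed.

Lemma loop_bracket_monE u v k l : u \in homog (parz k) -> v \in homog (parz l) ->
  loop_bracket br circ (tmon u k) (tmon v l) = bracket_term br circ k l u v.
Proof.
move=> uk vl; rewrite /loop_bracket (@fsum_pt _ _ k) => [|i ik].
  rewrite (@fsum_pt _ _ l) ?tmonE ?eqxx // => j jl.
  by rewrite tmonE // (negPf jl) term0r.
by rewrite fsbig1 // => j _; rewrite tmonE // (negPf ik) term0l.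
Qed.

Lemma loop_bracket_tmon (a b : bool) (u v : A) (m n : int) :
  u \in homog a -> v \in homog b ->
  let e (k : int) (c : nat) := k * 2 + c%:Z in
  loop_bracket br circ (tmon u (e m a)) (tmon v (e n b)) =
    tmon (br u v) (e (m + n) (a + b)%N)
    + (m%:~R + (a : nat)%:R / 2) *: tmon (circ u v) (e (m + n - 1) (a + b)%N)
    - ksign K a b *: ((n%:~R + (b : nat)%:R / 2)
                       *: tmon (circ v u) (e (m + n - 1) (a + b)%N)).
Proof.
move=> ua vb e; rewrite loop_bracket_monE /e ?parz_half // /bracket_term !parz_half.
have -> : m * 2 + a%:Z + (n * 2 + b%:Z) = (m + n) * 2 + (a + b)%N%:Z.
  by rewrite addrACA -mulrDl PoszD.
have -> : (m + n) * 2 + (a + b)%N%:Z - 2 = (m + n - 1) * 2 + (a + b)%N%:Z.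
  by rewrite mulrBl mul1r addrAC.
have eE (k : int) (c : bool) :
    (k * 2 + c%:Z)%:~R / 2 = k%:~R + (c : nat)%:R / 2 :> K.
  by rewrite rmorphD rmorphM /= mulrDl mulfK ?pnatr_eq0.
by rewrite !eE.
Qed.

Lemma loop_bracket_bilinear : even_bilinear (loop_bracket br circ).
Proof.
have fin2 (f g : loop) i :
    finite_set [set j | bracket_term br circ i j (f i) (g j) != 0].
  by apply: (sub_supp (f := g)) => j ->; rewrite term0r.
have fin1 (f g : loop) : finite_set [set i |
    \sum_(j \in [set: int]) bracket_term br circ i j (f i) (g j) != 0].
  apply: (sub_supp (f := f)) => i ->.
  by rewrite fsbig1 // => j _; rewrite term0l.
have hl (f : loop) k : f k \in homog (parz k) by have [] := loop_coefP f.
split; first split=> [g c f f'|f c g g']; rewrite /loop_bracket /=.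
- rewrite -fsum_lin //; apply: eq_fsbigr => i _; rewrite -fsum_lin //.
  by apply: eq_fsbigr => j _; rewrite term_linl.
- rewrite -fsum_lin //; apply: eq_fsbigr => i _; rewrite -fsum_lin //.
  by apply: eq_fsbigr => j _; rewrite term_linr.
move=> a b f g /asboolP fa /asboolP gb; rewrite /loop_bracket.
have [l0 lS] := loop_homog_submod (a (+) b).
have lsum (F : int -> loop) : (forall i, F i \in loop_homog (a (+) b)) ->
    \sum_(i \in [set: int]) F i \in loop_homog (a (+) b).
  move=> hF; elim/big_rec: _ => // i x _ hx.
  by rewrite -[F i]scale1r; apply: lS.
apply: (lsum) => i; apply: (lsum) => j.
have [ia|/fa ->] := eqVneq (parz i) a; last by rewrite term0l.
have [jb|/gb ->] := eqVneq (parz j) b; last by rewrite term0r.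
have ht u k : parz k = a (+) b -> tmon u k \in loop_homog (a (+) b).
  move=> kab; apply/asboolP => l lab.
  have [uk|/tmon_bad -> //] := boolP (u \in homog (parz k)).
  by rewrite tmonE //; have [E|//] := eqVneq l k; rewrite E kab eqxx in lab.
have e1 : parz (i + j) = a (+) b by rewrite parzD ia jb.
have e2 : parz (i + j - 2) = a (+) b by rewrite par2.
rewrite /bracket_term -scaleNr addrC; apply: (lS).
  by rewrite -[_ *: _]addr0; apply: lS => //; exact: ht.
by rewrite addrC; apply: lS; exact: ht.
Qed.

End Bracket.

End Loop.

(* Main.v *)
(** On monomials [u t^p], [v t^q], [w t^r] with half-integral exponents, the
    Hom-Jacobiator of the loop bracket has components in degrees [p+q+r],
    [p+q+r-1] and [p+q+r-2]. Given skew-symmetry, these are respectively the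
    Hom-Jacobiator of [u, v, w], a cyclic sum of terms [p * G(u,v,w)], and a
    cyclic sum of terms [p(p-1) * N(u,v,w) + pq * S(u,v,w)], where [G], [N], [S]
    are the defects of the Gel'fand-Dorfman, right-commutativity and
    left-symmetry identities. So the identities of [A] make every component
    vanish; conversely [p], [q], [r] vary independently in classes modulo
    integers, and finite differences in [p] and [q] isolate each defect. *)

Require Import Defs.
From HB Require Import structures.
From mathcomp Require Import all_boot all_order all_algebra.
From mathcomp Require Import reals complex.
From mathcomp Require Import boolp zify ring.

Set Implicit Arguments.
Unset Strict Implicit.
Unset Printing Implicit Defensive.

Import GRing.Theory Num.Theory.
Local Open Scope ring_scope.

(** * Identities between linear combinations *)

Section LinearCombinations.
Variables (K : comNzRingType) (A : lmodType K).

Inductive lexp :=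
  | LVar of nat | LZero | LAdd of lexp & lexp | LOpp of lexp
  | LScale of K & lexp.

Fixpoint leval (env : seq A) e : A :=
  match e with
  | LVar n => nth 0 env n
  | LZero => 0
  | LAdd e1 e2 => leval env e1 + leval env e2
  | LOpp e1 => - leval env e1
  | LScale c e1 => c *: leval env e1
  end.

Fixpoint lcoef e (i : nat) : K :=
  match e with
  | LVar n => if eqn i n then 1 else 0
  | LZero => 0
  | LAdd e1 e2 => lcoef e1 i + lcoef e2 i
  | LOpp e1 => - lcoef e1 i
  | LScale c e1 => c * lcoef e1 i
  end.

(** A recursion rather than a bounded quantifier, so that [cbv] unfolds it into one scalar equation
    per atom, ready for [ring]. *)
Fixpoint lcoef_eq n e1 e2 : Prop :=
  if n is m.+1 then lcoef e1 m = lcoef e2 m /\ lcoef_eq m e1 e2 else True.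

Lemma leval_coef env e :
  leval env e = \sum_(i < size env) lcoef e i *: nth 0 env i.
Proof.
elim: e => [n||e1 IH1 e2 IH2|e1 IH1|c e1 IH1].
- have lcE (i : nat) : lcoef (LVar n) i = if i == n then 1 else 0 by [].
  rewrite [LHS]/=; have [nlt|nge] := ltnP n (size env); last first.
    (* A variable beyond the environment reads the default [0], and no index of the sum reaches
       it. *)
    rewrite nth_default // big1 // => i _; rewrite lcE; case: eqP => [E|_].
      by have := ltn_ord i; rewrite E ltnNge nge.
    by rewrite scale0r.
  rewrite (bigD1 (Ordinal nlt)) // big1 => [|i]; last first.
    by rewrite -val_eqE lcE => /negPf ->; rewrite scale0r.
  by rewrite lcE eqxx scale1r /= addr0.
- by rewrite big1 // => i _; rewrite scale0r.
- by rewrite /= IH1 IH2 -big_split; apply: eq_bigr => i _; rewrite scalerDl.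
- by rewrite /= IH1 -sumrN; apply: eq_bigr => i _; rewrite scaleNr.
- by rewrite /= IH1 scaler_sumr; apply: eq_bigr => i _; rewrite scalerA.
Qed.

Lemma leval_eq env e1 e2 :
  lcoef_eq (size env) e1 e2 -> leval env e1 = leval env e2.
Proof.
move=> h; rewrite !leval_coef; apply: eq_bigr => i _; congr (_ *: _).
move: (size env) h i => n; elim: n => [_ []//|n IH [e h] i].
have [->//|lt] := eqVneq (i : nat) n.
have lt' : (i < n)%N by rewrite ltn_neqAle lt -ltnS ltn_ord.
exact: IH h (Ordinal lt').
Qed.

End LinearCombinations.

Ltac lmod_find x env :=
  lazymatch env with
  | x :: _ => constr:(O)
  | _ :: ?env' => let n := lmod_find x env' in constr:(S n)
  end.
Ltac lmod_atoms env e :=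
  lazymatch e with
  | @GRing.zero _ => env
  | @GRing.add _ ?x ?y => let env := lmod_atoms env x in lmod_atoms env y
  | @GRing.opp _ ?x => lmod_atoms env x
  | @GRing.scale _ _ _ ?x => lmod_atoms env x
  | _ => match env with
         | context [cons e _] => env
         | _ => constr:(e :: env)
         end
  end.
Ltac lmod_reify K env e :=
  lazymatch e with
  | @GRing.zero _ => constr:(@LZero K)
  | @GRing.add _ ?x ?y =>
      let x := lmod_reify K env x in let y := lmod_reify K env y in
      constr:(@LAdd K x y)
  | @GRing.opp _ ?x => let x := lmod_reify K env x in constr:(@LOpp K x)
  | @GRing.scale _ _ ?c ?x =>
      let x := lmod_reify K env x in constr:(@LScale K c x)
  | _ => let n := lmod_find e env in constr:(@LVar K n)
  end.
(* Reduces an equation between linear combinations to the equality of the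
   coefficients of each atom; sufficient, not necessary, for the equation. *)
Ltac lmod_coefs K A :=
  lazymatch goal with
  | |- ?l = ?r =>
    let env := lmod_atoms (@nil A) l in
    let env := lmod_atoms env r in
    let l' := lmod_reify K env l in
    let r' := lmod_reify K env r in
    refine (@leval_eq K _ env l' r' _);
    cbv [lcoef_eq size lcoef eqn];
    repeat match goal with |- _ /\ _ => split end;
    try exact Logic.I
  end.

(** * Superspaces and loop spaces *)

Section Space.
Variables (K : numFieldType) (A : superspaceType K).
Implicit Types u v w : A.

Lemma homogD a u v : u \in homog a -> v \in homog a -> u + v \in homog a.
Proof.
have [_ h] := homog_submod_closed (s := A) a => hu hv.
by rewrite -[u]scale1r; exact: h.
Qed.

Lemma homogZ a c u : u \in homog a -> c *: u \in homog a.
Proof.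
have [h0 h] := homog_submod_closed (s := A) a => hu.
by rewrite -[_ *: _]addr0; apply: h.
Qed.

Lemma homogN a u : u \in homog a -> - u \in homog a.
Proof. by rewrite -scaleN1r; exact: homogZ. Qed.

Section EvenBilinear.
Variables (op : A -> A -> A) (op_even : even_bilinear op).

Lemma ebilDl u v w : op (u + v) w = op u w + op v w.
Proof. by have [[l _] _] := op_even; have := l w 1 u v; rewrite /= !scale1r. Qed.

Lemma ebilDr u v w : op w (u + v) = op w u + op w v.
Proof. by have [[_ r] _] := op_even; have := r w 1 u v; rewrite /= !scale1r. Qed.

Lemma ebil0l w : op 0 w = 0.
Proof. by apply: (addrI (op 0 w)); rewrite -ebilDl !addr0. Qed.

Lemma ebil0r w : op w 0 = 0.
Proof. by apply: (addrI (op w 0)); rewrite -ebilDr !addr0. Qed.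

Lemma ebilZl c u w : op (c *: u) w = c *: op u w.
Proof.
by have [[l _] _] := op_even; have := l w c u 0; rewrite /= ebil0l !addr0.
Qed.

Lemma ebilZr c u w : op w (c *: u) = c *: op w u.
Proof.
by have [[_ r] _] := op_even; have := r w c u 0; rewrite /= ebil0r !addr0.
Qed.

Lemma ebilNl u w : op (- u) w = - op u w.
Proof. by rewrite -scaleN1r ebilZl scaleN1r. Qed.

Lemma ebilNr u w : op w (- u) = - op w u.
Proof. by rewrite -scaleN1r ebilZr scaleN1r. Qed.

Definition ebilE := (ebilDl, ebilDr, ebilNl, ebilNr, ebilZl, ebilZr).

Lemma ebil_homog a b u v :
  u \in homog a -> v \in homog b -> op u v \in homog (a (+) b).
Proof. by have [_ h] := op_even; exact: h. Qed.

End EvenBilinear.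

Lemma elinD f u v : @even_linear _ A f -> f (u + v) = f u + f v.
Proof. by move=> [l _]; have := l 1 u v; rewrite !scale1r. Qed.

Lemma ksignC a b : ksign K a b = ksign K b a.
Proof. by rewrite /ksign mulnC. Qed.

Lemma tmonD u v k : u \in homog (parz k) -> v \in homog (parz k) ->
  tmon (u + v) k = tmon u k + tmon v k.
Proof.
by move=> hu hv; have := tmon_linear 1 hu hv; rewrite !scale1r.
Qed.

Lemma tmonZ c u k : u \in homog (parz k) -> tmon (c *: u) k = c *: tmon u k.
Proof.
by move=> hu; have := tmon_linear c hu (homog0 A _); rewrite tmon0 !addr0.
Qed.

Lemma tmonN u k : u \in homog (parz k) -> tmon (- u) k = - tmon u k.
Proof. by move=> hu; rewrite -scaleN1r tmonZ // scaleN1r. Qed.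

Lemma tmon_homog u k a : parz k = a -> u \in homog a ->
  tmon u k \in homog a.
Proof.
move=> <- hu; apply/asboolP => j; rewrite tmonE //.
by have [->|//] := eqVneq j k; rewrite eqxx.
Qed.

(** A loop is the finite sum of its monomials, and homogeneity kills those of the wrong parity.
    Applied to one argument at a time, this reduces multilinear identities to monomials. *)
Lemma loop_additive_eq0 a (T : loop A -> loop A) :
  {morph T : f g / f + g} ->
  (forall u k, parz k = a -> u \in homog a -> T (tmon u k) = 0) ->
  forall f, f \in homog a -> T f = 0.
Proof.
move=> TD Tt f /asboolP fa; rewrite (loop_tmon_sum f).
have T0 : T 0 = 0 by apply: (addrI (T 0)); rewrite -TD !addr0.
elim/big_rec: _ => // k g _ Tg; rewrite TD Tg addr0.
have [ka|/fa ->] := eqVneq (parz k) a; last by rewrite tmon0.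
by apply: Tt => //; rewrite -ka; have [_] := loop_coefP f.
Qed.

Lemma parzB2 k : parz (k - 2) = parz k.
Proof. by rewrite parzD addbF. Qed.

(** The three indices are distinct, so evaluating the sum at each isolates one coefficient. They
    encode exponents that drop by 1, the three degrees of the Jacobiator. *)
Lemma tmon3_eq0 n u v w : u \in homog (parz n) -> v \in homog (parz n) ->
  w \in homog (parz n) ->
  tmon u n + tmon v (n - 2) + tmon w (n - 2 - 2) = 0 ->
  [/\ u = 0, v = 0 & w = 0].
Proof.
move=> hu hv hw E; have coef j : (if j == n then u else 0)
    + (if j == n - 2 then v else 0) + (if j == n - 2 - 2 then w else 0) = 0.
  by rewrite -!tmonE ?parzB2 // -!loopD E.
split.
- move: (coef n); rewrite eqxx !ifF ?addr0 //; lia.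
- move: (coef (n - 2)); rewrite eqxx !ifF ?addr0 ?add0r //; lia.
- move: (coef (n - 2 - 2)); rewrite eqxx !ifF ?addr0 ?add0r //; lia.
Qed.

End Space.

(** * The Jacobiator of monomials *)

Section Coefficients.
Variables (K : numFieldType) (A : superspaceType K).
Variables (br circ : A -> A -> A) (alpha : A -> A).
Hypotheses (br_even : even_bilinear br) (circ_even : even_bilinear circ).
Hypothesis alpha_even : even_linear alpha.
Implicit Types (a b c : bool) (p q r : K) (i j k : int) (u v w : A).

(* The exponent of [t] encoded by the index [i]. *)
Definition half i : K := i%:~R / 2.

(** The coefficient of [t^(p+q-1)] in the bracket of [u t^p] and [v t^q], with [s] in place of the
    sign. *)
Definition lower s p q u v := p *: circ u v - s *: (q *: circ v u).

Definition cyclic_sum a b c p q r u v w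
    (F : bool -> bool -> bool -> K -> K -> K -> A -> A -> A -> A) :=
  ksign K a c *: F a b c p q r u v w + ksign K a b *: F b c a q r p v w u
  + ksign K b c *: F c a b r p q w u v.

(* [degN] is the component of degree [p+q+r-N] of the loop bracket
   [[[u t^p, v t^q], alpha(w) t^r]], for [u], [v], [w] of parities [a], [b],
   [c]. All three take the same arguments so that [cyclic_sum] applies. *)
Definition deg0 (a b c : bool) (p q r : K) u v w := br (br u v) (alpha w).

Definition deg1 a b c p q r u v w :=
  lower (ksign K (a (+) b) c) (p + q) r (br u v) (alpha w)
  + br (lower (ksign K a b) p q u v) (alpha w).

Definition deg2 a b c p q r u v w :=
  lower (ksign K (a (+) b) c) (p + q - 1) r (lower (ksign K a b) p q u v)
    (alpha w).

(** * Defects of the identities and their cyclic sums *)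

Definition gd_defect (b c : bool) u v w :=
  br (circ u v) (alpha w) - ksign K b c *: br (circ u w) (alpha v)
  + circ (br u v) (alpha w) - ksign K b c *: circ (br u w) (alpha v)
  - circ (alpha u) (br v w).

Definition leftsym_defect (a b : bool) u v w :=
  circ (circ u v) (alpha w) - circ (alpha u) (circ v w)
  - ksign K a b *: (circ (circ v u) (alpha w) - circ (alpha v) (circ u w)).

Definition rightcomm_defect (b c : bool) u v w :=
  circ (circ u v) (alpha w) - ksign K b c *: circ (circ u w) (alpha v).

Definition deg1_defect (a b c : bool) p (q r : K) u v w :=
  p *: gd_defect b c u v w.

Definition deg2_defect a b c p q (r : K) u v w :=
  (p * (p - 1)) *: rightcomm_defect b c u v w
  + (p * q) *: leftsym_defect a b u v w.

(** Each of [p], [q], [r] occurs linearly. The multiples of [p] in the three rotated terms add up to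
    [gd_defect] once skew-symmetry turns [br w u] into [br u w]; likewise for [q] and [r]. *)
Lemma cyclic_deg1E a b c p q r u v w :
  br v u = - (ksign K a b *: br u v) -> br w v = - (ksign K b c *: br v w) ->
  br w u = - (ksign K a c *: br u w) ->
  cyclic_sum a b c p q r u v w deg1 =
  cyclic_sum a b c p q r u v w deg1_defect.
Proof.
move=> vu wv wu; rewrite /cyclic_sum /deg1 /deg1_defect /gd_defect /lower.
rewrite vu wv wu !(ebilE br_even, ebilE circ_even) /ksign.
by case: a b c {vu wv wu} => [] [] []; rewrite /= ?expr0 ?expr1;
  lmod_coefs K A; ring.
Qed.

(** The coefficient of [circ (circ u v) (alpha w)] splits as [p (p + q - 1) = p (p - 1) + p q],
    which shares this product between the right-commutativity and left-symmetry defects. *)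
Lemma cyclic_deg2E a b c p q r u v w :
  cyclic_sum a b c p q r u v w deg2 =
  cyclic_sum a b c p q r u v w deg2_defect.
Proof.
rewrite /cyclic_sum /deg2 /deg2_defect /leftsym_defect /rightcomm_defect /lower.
rewrite !(ebilE br_even, ebilE circ_even) /ksign.
by case: a b c => [] [] []; rewrite /= ?expr0 ?expr1; lmod_coefs K A; ring.
Qed.

(** The sum is affine in [p], and the difference is its slope. *)
Lemma cyclic_deg1_diff a b c p q r u v w :
  cyclic_sum a b c (p + 1) q r u v w deg1_defect
  - cyclic_sum a b c p q r u v w deg1_defect =
  ksign K a c *: gd_defect b c u v w.
Proof. by rewrite /cyclic_sum /deg1_defect; lmod_coefs K A; ring. Qed.

(** The mixed difference in [p] and [q] kills every term but the one in [p q]. *)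
Lemma cyclic_deg2_diff_pq a b c p q r u v w :
  cyclic_sum a b c (p + 1) (q + 1) r u v w deg2_defect
  - cyclic_sum a b c (p + 1) q r u v w deg2_defect
  - cyclic_sum a b c p (q + 1) r u v w deg2_defect
  + cyclic_sum a b c p q r u v w deg2_defect =
  ksign K a c *: leftsym_defect a b u v w.
Proof. by rewrite /cyclic_sum /deg2_defect; lmod_coefs K A; ring. Qed.

(** The second difference of [p (p - 1)] is 2, and all other terms are affine in [p]. *)
Lemma cyclic_deg2_diff_pp a b c p q r u v w :
  cyclic_sum a b c (p + 1 + 1) q r u v w deg2_defect
  - cyclic_sum a b c (p + 1) q r u v w deg2_defect
  - cyclic_sum a b c (p + 1) q r u v w deg2_defect
  + cyclic_sum a b c p q r u v w deg2_defect =
  (2 * ksign K a c) *: rightcomm_defect b c u v w.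
Proof. by rewrite /cyclic_sum /deg2_defect; lmod_coefs K A; ring. Qed.

(** * Single and iterated brackets of monomials *)

Lemma lower_homog s p q a b u v : u \in homog a -> v \in homog b ->
  lower s p q u v \in homog (a (+) b).
Proof.
move=> hu hv; apply: homogD; last apply: homogN.
  by apply: homogZ; apply: ebil_homog.
by do 2!apply: homogZ; rewrite addbC; apply: ebil_homog.
Qed.

Lemma loop_bracket_tmonE i j u v : u \in homog (parz i) ->
  v \in homog (parz j) ->
  loop_bracket br circ (tmon u i) (tmon v j) = tmon (br u v) (i + j)
    + tmon (lower (ksign K (parz i) (parz j)) (half i) (half j) u v)
        (i + j - 2).
Proof.
move=> hu hv; rewrite loop_bracket_monE // /bracket_term -addrA; congr (_ + _).
have cuv : circ u v \in homog (parz (i + j - 2)).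
  by rewrite parzB2 parzD; apply: ebil_homog.
have cvu : circ v u \in homog (parz (i + j - 2)).
  by rewrite parzB2 parzD addbC; apply: ebil_homog.
by rewrite tmonD ?tmonN ?tmonZ //; do ?[apply: homogN | apply: homogZ].
Qed.

Lemma halfD i j : half (i + j) = half i + half j.
Proof. by rewrite /half intrD mulrDl. Qed.

Lemma half2 : half 2 = 1.
Proof. by rewrite /half divff // pnatr_eq0. Qed.

Lemma halfN i : half (- i) = - half i.
Proof. by rewrite /half mulrNz mulNr. Qed.

Section Homogeneous.
Variables (a b c : bool) (u v w : A).
Hypotheses (hu : u \in homog a) (hv : v \in homog b) (hw : w \in homog c).

Lemma deg0_homog p q r : deg0 a b c p q r u v w \in homog (a (+) b (+) c).
Proof.
have aw : alpha w \in homog c by have [_ ->] := alpha_even.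
by rewrite /deg0; do 2?apply: ebil_homog.
Qed.

Lemma deg1_homog p q r : deg1 a b c p q r u v w \in homog (a (+) b (+) c).
Proof.
have aw : alpha w \in homog c by have [_ ->] := alpha_even.
apply: homogD; first by apply: lower_homog => //; apply: ebil_homog.
by apply: ebil_homog => //; apply: lower_homog.
Qed.

Lemma deg2_homog p q r : deg2 a b c p q r u v w \in homog (a (+) b (+) c).
Proof.
have aw : alpha w \in homog c by have [_ ->] := alpha_even.
by rewrite /deg2; do 2?apply: lower_homog.
Qed.

Lemma loop_bracket_bracket i j k : parz i = a -> parz j = b -> parz k = c ->
  let n := i + j + k in
  loop_bracket br circ (loop_bracket br circ (tmon u i) (tmon v j))
    (loop_map alpha (tmon w k)) =
  tmon (deg0 a b c (half i) (half j) (half k) u v w) n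
  + tmon (deg1 a b c (half i) (half j) (half k) u v w) (n - 2)
  + tmon (deg2 a b c (half i) (half j) (half k) u v w) (n - 2 - 2).
Proof.
move=> ia jb kc n; have aw : alpha w \in homog c by have [_ ->] := alpha_even.
have bruv : br u v \in homog (a (+) b) by apply: ebil_homog.
have lowuv s p q : lower s p q u v \in homog (a (+) b) by apply: lower_homog.
rewrite loop_map_tmon ?kc // loop_bracket_tmonE ?ia ?jb //.
rewrite (ebilDl (loop_bracket_bilinear br_even circ_even)).
rewrite !loop_bracket_tmonE ?parzB2 ?parzD ?ia ?jb ?kc //.
have -> : i + j - 2 + k = n - 2 by rewrite /n; ring.
(* Index [n - 2] receives two contributions, the exponent being lowered either by the outer bracket
   or by the inner one. *)
rewrite /deg1 (tmonD (u := lower _ _ _ _ _) (v := br _ _)); last 2 first.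
- by rewrite parzB2 /n !parzD ia jb kc; apply: lower_homog.
- by rewrite parzB2 /n !parzD ia jb kc; apply: ebil_homog.
(* [half (i + j - 2)] is the factor [p + q - 1] of [deg2]. *)
by rewrite /deg2 !halfD halfN half2 !addrA.
Qed.

End Homogeneous.

(** * The Jacobiator on the loop space *)

Definition loop_jacobiator a b c (f g h : loop A) :=
  let lbr := loop_bracket br circ in
  let phi := loop_map alpha in
  ksign K a c *: lbr (lbr f g) (phi h) + ksign K a b *: lbr (lbr g h) (phi f)
  + ksign K b c *: lbr (lbr h f) (phi g).

Lemma loop_jacobiatorD a b c f f' g h : loop_jacobiator a b c (f + f') g h =
  loop_jacobiator a b c f g h + loop_jacobiator a b c f' g h.
Proof.
rewrite /loop_jacobiator (elinD _ _ (loop_map_even alpha_even)).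
rewrite !(ebilE (loop_bracket_bilinear br_even circ_even)).
by lmod_coefs K (loop A); ring.
Qed.

(** Brings each argument in turn to the first place, so that additivity there serves for all
    three. *)
Lemma loop_jacobiator_cycle a b c f g h :
  loop_jacobiator a b c f g h = loop_jacobiator b c a g h f.
Proof.
by rewrite /loop_jacobiator (ksignC K b a) (ksignC K c a) [RHS]addrC addrA.
Qed.

Section JacobiatorMonomials.
Variables (a b c : bool) (u v w : A) (i j k : int).
Hypotheses (hu : u \in homog a) (hv : v \in homog b) (hw : w \in homog c).
Hypotheses (ia : parz i = a) (jb : parz j = b) (kc : parz k = c).

Let cyc := cyclic_sum a b c (half i) (half j) (half k) u v w.

Definition homog3 (F : bool -> bool -> bool -> K -> K -> K -> A -> A -> A -> A)
  := forall a b c p q r u v w, u \in homog a -> v \in homog b ->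
     w \in homog c -> F a b c p q r u v w \in homog (a (+) b (+) c).

Lemma cyclic_sum_homog F : homog3 F -> cyc F \in homog (a (+) b (+) c).
Proof.
move=> hF; rewrite /cyc /cyclic_sum.
apply: homogD; first apply: homogD; apply: homogZ; first exact: hF.
  by rewrite -addbA addbC; apply: hF.
by rewrite addbC addbA; apply: hF.
Qed.

Lemma tmon_cyclic_sum F n : homog3 F -> parz n = a (+) b (+) c ->
  tmon (cyc F) n =
  ksign K a c *: tmon (F a b c (half i) (half j) (half k) u v w) n
  + ksign K a b *: tmon (F b c a (half j) (half k) (half i) v w u) n
  + ksign K b c *: tmon (F c a b (half k) (half i) (half j) w u v) n.
Proof.
move=> hF hn; rewrite /cyc /cyclic_sum.
have h1 := hF a b c (half i) (half j) (half k) u v w hu hv hw.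
have h2 := hF b c a (half j) (half k) (half i) v w u hv hw hu.
have h3 := hF c a b (half k) (half i) (half j) w u v hw hu hv.
rewrite addbC addbA -hn in h2; rewrite -addbA addbC -hn in h3.
rewrite -hn in h1.
by rewrite !tmonD ?tmonZ //; do ?apply: homogD; apply: homogZ.
Qed.

Lemma loop_jacobiator_tmon : let n := i + j + k in
  loop_jacobiator a b c (tmon u i) (tmon v j) (tmon w k) =
  tmon (cyc deg0) n + tmon (cyc deg1) (n - 2) + tmon (cyc deg2) (n - 2 - 2).
Proof.
have hn : parz (i + j + k) = a (+) b (+) c by rewrite !parzD ia jb kc.
rewrite /loop_jacobiator (loop_bracket_bracket hu hv hw) //.
rewrite (loop_bracket_bracket hv hw hu) // (loop_bracket_bracket hw hu hv) //.
have -> : j + k + i = i + j + k by ring.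
have -> : k + i + j = i + j + k by ring.
rewrite /= !tmon_cyclic_sum ?parzB2 //; first by lmod_coefs K (loop A); ring.
- by move=> *; exact: deg2_homog.
- by move=> *; exact: deg1_homog.
- by move=> *; exact: deg0_homog.
Qed.

Lemma loop_jacobiator_tmon_eq0 :
  loop_jacobiator a b c (tmon u i) (tmon v j) (tmon w k) = 0 <->
  [/\ cyc deg0 = 0, cyc deg1 = 0 & cyc deg2 = 0].
Proof.
rewrite loop_jacobiator_tmon; split=> [|[-> -> ->]]; last first.
  by rewrite !tmon0 !addr0.
have hn : parz (i + j + k) = a (+) b (+) c by rewrite !parzD ia jb kc.
apply: tmon3_eq0; rewrite hn; apply: cyclic_sum_homog => *.
- by move=> *; exact: deg0_homog.
- by move=> *; exact: deg1_homog.
- by move=> *; exact: deg2_homog.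
Qed.

End JacobiatorMonomials.

(** * Transfer of skew-symmetry *)

Lemma br_skew_of_loop :
  (forall a b (f g : loop A), f \in homog a -> g \in homog b ->
     loop_bracket br circ f g = - (ksign K a b *: loop_bracket br circ g f)) ->
  forall a b u v, u \in homog a -> v \in homog b ->
    br u v = - (ksign K a b *: br v u).
Proof.
(* Test monomials [u t^(a/2)] and [v t^(b/2)]; any indices of the right parities would serve. *)
move=> lskew a b u v hu hv; pose i : int := (a : nat)%:Z.
pose j : int := (b : nat)%:Z.
have [ia jb] : parz i = a /\ parz j = b by rewrite /i /j; case: (a); case: (b).
have := lskew _ _ _ _ (tmon_homog ia hu) (tmon_homog jb hv).
rewrite !loop_bracket_tmonE ?ia ?jb // -scaleNr [j + i]addrC.
(* The top coefficient contains only [br], since the [circ] part sits at index [i + j - 2]. *)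
move/(congr1 (fun f : loop A => f (i + j))).
have ij : (i + j == i + j - 2) = false by lia.
rewrite !(loopD, loopZ) !tmonE ?parzB2 ?parzD ?ia ?jb //.
  by rewrite eqxx ij !addr0 scaleNr.
all: by [exact: ebil_homog | rewrite addbC; exact: ebil_homog
  | exact: lower_homog | rewrite addbC; exact: lower_homog].
Qed.

Lemma loop_skew :
  (forall a b u v, u \in homog a -> v \in homog b ->
    br u v = - (ksign K a b *: br v u)) ->
  forall a b (f g : loop A), f \in homog a -> g \in homog b ->
    loop_bracket br circ f g = - (ksign K a b *: loop_bracket br circ g f).
Proof.
move=> skew a b f g hf hg.
have lE := ebilE (loop_bracket_bilinear br_even circ_even).
apply/eqP; rewrite -addr_eq0; apply/eqP; move: f hf.
apply: loop_additive_eq0 => [f f'|u i ia hu].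
  by rewrite !lE; lmod_coefs K (loop A); ring.
move: g hg; apply: loop_additive_eq0 => [g g'|v j jb hv].
  by rewrite !lE; lmod_coefs K (loop A); ring.
rewrite !loop_bracket_tmonE ?ia ?jb // (skew _ _ _ _ hu hv).
have -> : j + i = i + j by ring.
(* The [circ] part is skew by its very form: exchanging the arguments swaps its two products, and
   the sign squares to 1. *)
have -> p q : lower (ksign K a b) p q u v
    = - (ksign K a b *: lower (ksign K b a) q p v u).
  rewrite /lower /ksign.
  by case: a b {ia jb hu hv} => [] []; rewrite /= ?expr0 ?expr1;
    lmod_coefs K A; ring.
rewrite !tmonN ?tmonZ ?parzB2 ?parzD ?ia ?jb.
  by rewrite (ksignC K b a); lmod_coefs K (loop A); ring.
all: rewrite addbC; do ?apply: homogZ.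
all: by [exact: ebil_homog | exact: lower_homog].
Qed.

(** * Transfer of the Hom-Jacobi identity *)

Lemma ksign_neq0 a b : ksign K a b != 0.
Proof. by rewrite /ksign signr_eq0. Qed.

Lemma defects_of_loop_jacobi :
  (forall a b u v, u \in homog a -> v \in homog b ->
    br u v = - (ksign K a b *: br v u)) ->
  (forall a b c (f g h : loop A), f \in homog a -> g \in homog b ->
     h \in homog c -> loop_jacobiator a b c f g h = 0) ->
  forall a b c u v w, u \in homog a -> v \in homog b -> w \in homog c ->
  [/\ cyclic_sum a b c 0 0 0 u v w deg0 = 0, gd_defect b c u v w = 0,
      leftsym_defect a b u v w = 0 & rightcomm_defect b c u v w = 0].
Proof.
move=> skew ljac a b c u v w hu hv hw; pose k : int := (c : nat)%:Z.
have kc : parz k = c by rewrite /k; case: (c).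
have jac i j : parz i = a -> parz j = b ->
    let cyc := cyclic_sum a b c (half i) (half j) (half k) u v w in
    [/\ cyc deg0 = 0, cyc deg1 = 0 & cyc deg2_defect = 0].
  move=> ia jb cyc; rewrite /cyc -cyclic_deg2E.
  apply/(loop_jacobiator_tmon_eq0 hu hv hw ia jb kc)/ljac; exact: tmon_homog.
pose i : int := (a : nat)%:Z; pose j : int := (b : nat)%:Z.
have [ia jb] : parz i = a /\ parz j = b by rewrite /i /j; case: (a); case: (b).
(* Adding 2 to an index keeps its parity and raises the exponent by 1, which gives the sample points
   of the finite differences. *)
have par2 m : parz (m + 2) = parz m by rewrite parzD addbF.
have half_add2 m : half (m + 2) = half m + 1 by rewrite halfD half2.
have i2 : parz (i + 2) = a by rewrite par2.
have i4 : parz (i + 2 + 2) = a by rewrite par2.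
have j2 : parz (j + 2) = b by rewrite par2.
have [J0 J1 J2] := jac _ _ ia jb.
have [_ J1p J2p] := jac _ _ i2 jb; have [_ _ J2q] := jac _ _ ia j2.
have [_ _ J2pq] := jac _ _ i2 j2; have [_ _ J2pp] := jac _ _ i4 jb.
rewrite !half_add2 in J1p J2p J2q J2pq J2pp.
have [[vu wv] wu] := (skew _ _ _ _ hv hu, skew _ _ _ _ hw hv, skew _ _ _ _ hw hu).
rewrite ksignC in vu; rewrite ksignC in wv; rewrite ksignC in wu.
rewrite !cyclic_deg1E // in J1 J1p.
(* [deg0] ignores the exponents, so [J0] at the sampled ones is convertible to the claim at [0]. *)
split; first exact: J0.
all: apply/eqP.
- move/eqP: (cyclic_deg1_diff a b c (half i) (half j) (half k) u v w).
  by rewrite J1 J1p subr0 eq_sym scaler_eq0 (negPf (ksign_neq0 _ _)).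
- move/eqP: (cyclic_deg2_diff_pq a b c (half i) (half j) (half k) u v w).
  rewrite J2 J2p J2q J2pq !subr0 addr0 eq_sym scaler_eq0.
  by rewrite (negPf (ksign_neq0 _ _)).
- move/eqP: (cyclic_deg2_diff_pp a b c (half i) (half j) (half k) u v w).
  (* The factor 2 is cancelled in characteristic zero. *)
  rewrite J2 J2p J2pp !subr0 addr0 eq_sym scaler_eq0 mulf_eq0 pnatr_eq0.
  by rewrite (negPf (ksign_neq0 _ _)).
Qed.

Lemma loop_jacobi_of_defects :
  (forall a b u v, u \in homog a -> v \in homog b ->
    br u v = - (ksign K a b *: br v u)) ->
  (forall a b c u v w, u \in homog a -> v \in homog b -> w \in homog c ->
  [/\ cyclic_sum a b c 0 0 0 u v w deg0 = 0, gd_defect b c u v w = 0,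
      leftsym_defect a b u v w = 0 & rightcomm_defect b c u v w = 0]) ->
  forall a b c (f g h : loop A), f \in homog a -> g \in homog b ->
    h \in homog c -> loop_jacobiator a b c f g h = 0.
Proof.
move=> skew defects a b c f g h hf hg hh; move: f hf.
apply: loop_additive_eq0 => [f f'|u i ia hu]; first exact: loop_jacobiatorD.
rewrite loop_jacobiator_cycle; move: g hg.
apply: loop_additive_eq0 => [g g'|v j jb hv]; first exact: loop_jacobiatorD.
rewrite loop_jacobiator_cycle; move: h hh.
apply: loop_additive_eq0 => [h h'|w k kc hw]; first exact: loop_jacobiatorD.
rewrite loop_jacobiator_cycle.
apply/(loop_jacobiator_tmon_eq0 hu hv hw ia jb kc).
have [[vu wv] wu] := (skew _ _ _ _ hv hu, skew _ _ _ _ hw hv, skew _ _ _ _ hw hu).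
rewrite ksignC in vu; rewrite ksignC in wv; rewrite ksignC in wu.
rewrite cyclic_deg1E // cyclic_deg2E.
have [D0 G1 L1 R1] := defects _ _ _ _ _ _ hu hv hw.
have [_ G2 L2 R2] := defects _ _ _ _ _ _ hv hw hu.
have [_ G3 L3 R3] := defects _ _ _ _ _ _ hw hu hv.
split; first exact: D0.
  by rewrite /cyclic_sum /deg1_defect G1 G2 G3 !scaler0 !addr0.
by rewrite /cyclic_sum /deg2_defect L1 L2 L3 R1 R2 R3 !scaler0 !addr0 !scaler0 !addr0.
Qed.

(** * The equivalence *)

Lemma loop_hom_lieP :
  hom_lie_superalgebra (loop_bracket br circ) (loop_map alpha) <->
  super_hom_gelfand_dorfman br circ alpha.
Proof.
split=> [[_ _ lskew ljac]|].
  have skew := br_skew_of_loop lskew.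
  have defects := defects_of_loop_jacobi skew ljac.
  split.
  - split=> // a b c u v w hu hv hw.
    by have [D0 _ _ _] := defects _ _ _ _ _ _ hu hv hw.
  - split=> // a b c u v w hu hv hw; apply/eqP; rewrite -subr_eq0; apply/eqP.
      by have [_ _ L _] := defects _ _ _ _ _ _ hu hv hw.
    by have [_ _ _ R] := defects _ _ _ _ _ _ hu hv hw.
  - move=> a b c u v w hu hv hw.
    by have [_ G _ _] := defects _ _ _ _ _ _ hu hv hw.
move=> [[_ _ skew jac] [_ _ leftsym rightcomm] gd]; split.
- exact: loop_bracket_bilinear.
- exact: loop_map_even.
- exact: loop_skew.
apply: loop_jacobi_of_defects => // a b c u v w hu hv hw; split.
- exact: jac hu hv hw.
- exact: gd hu hv hw.
- by rewrite /leftsym_defect (leftsym _ _ _ _ _ _ hu hv hw) subrr.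
- by rewrite /rightcomm_defect (rightcomm _ _ _ _ _ _ hu hv hw) subrr.
Qed.

End Coefficients.

Theorem theorem3p18 (R : realType) (A : superspaceType (complex R))
    (br circ : A -> A -> A) (alpha : A -> A)
    (br_even : even_bilinear br) (circ_even : even_bilinear circ)
    (alpha_even : even_linear alpha) :
  hom_lie_superalgebra (loop_bracket br circ) (loop_map alpha) <->
  super_hom_gelfand_dorfman br circ alpha.
Proof. exact: loop_hom_lieP. Qed.
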